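(* Let $A=D[x,y;\sigma,\tau,a]$ be a generalized Weyl algebra. For an ideal $I$ of $D$ put $$I':=I+\sum_{i\ge 1}\Big(D\sigma^i(I)(i,-i)+D\tau^i(I)(-i,i)\Big).$$ Then the following statements are equivalent. 1. $A$ is a simple ring. 2. (a) The elements $a$ and $\sigma(a)$ are regular in $D$; (b) for all nonzero ideals $I$ of $D$, $I'=D$; (c) none of the ring endomorphisms $\sigma^n$ ($n\ge 1$) of $D$ is equal to the ring endomorphism $\omega_d$ where $d$ is a $\sigma$-invariant, regular, left normal element of $D$. 3. (a) The elements $a$ and $\sigma(a)$ are regular in $D$; (b) for all nonzero ideals $I$ of $D$, $I'=D$; (c) none of the ring endomorphisms $\tau^n$ ($n\ge 1$) of $D$ is equal to the ring endomorphism $\omega_d$ where $d$ is a $\tau$-invariant, regular, left normal element of $D$. If one of the equivalent conditions holds then $\sigma$ and $\tau$ are monomorphisms of $D$.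
   Context: Generalized Weyl algebra (GWA): let $D$ be a ring (associative, with 1), $\sigma,\tau$ ring endomorphisms of $D$ and $a\in D$ such that $\tau\sigma(a)=a$, $ad=\tau\sigma(d)a$ and $\sigma(a)d=\sigma\tau(d)\sigma(a)$ for all $d\in D$. Then $A=D[x,y;\sigma,\tau,a]$ is the ring generated by $D$, $x$ and $y$ subject to the defining relations $xd=\sigma(d)x$, $yd=\tau(d)y$ for all $d\in D$, $yx=a$, $xy=\sigma(a)$. Products of endomorphisms are compositions. For $i\ge1$: $(i,-i):=\sigma^i(a)\sigma^{i-1}(a)\cdots\sigma(a)$ and $(-i,i):=\tau^{i-1}(a)\cdots\tau(a)a$, elements of $D$ (so that $x^iy^i=(i,-i)$ and $y^ix^i=(-i,i)$ in $A$). As usual $D\sigma^i(I)(i,-i)$ denotes the set of finite sums of products. An element $d\in D$ is left normal if $dD\subseteq Dd$; regular if it is neither a left nor a right zero divisor; $\sigma$-invariant if $\sigma(d)=d$. A regular (more generally left regular) left normal element $d$ determines a ring endomorphism $\omega_d$ of $D$ by $dd'=\omega_d(d')d$ for all $d'\in D$. *)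

(* Defs.v *)
From HB Require Import structures.
From mathcomp Require Export all_boot all_algebra.
From mathcomp Require Export generic_quotient boolp classical_sets.

Set Implicit Arguments.
Unset Strict Implicit.
Unset Printing Implicit Defensive.

Import GRing.Theory.

Local Open Scope ring_scope.
Local Open Scope classical_set_scope.
Local Open Scope quotient_scope.

(* Rings are [pzRingType]s: associative with 1, possibly zero. *)

(* Two-sided ideals, not necessarily proper. *)
Record ideal (R : pzRingType) (I : set R) : Prop := Ideal {
  ideal0 : I 0;
  idealD : forall x y, I x -> I y -> I (x + y);
  idealMl : forall r x, I x -> I (r * x);
  idealMr : forall r x, I x -> I (x * r) }.

Definition simple_ring (R : pzRingType) : Prop :=
  (1 : R) <> 0 /\ forall I : set R, ideal I -> I = [set 0] \/ I = setT.

Definition regular (R : pzRingType) (d : R) : Prop :=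
  GRing.lreg d /\ GRing.rreg d.

Definition left_normal (R : pzRingType) (d : R) : Prop :=
  [set d * r | r in setT] `<=` [set r * d | r in setT].

Section Omega.

Variables (R : pzRingType) (d : R) (rd : regular d) (nd : left_normal d).

Fact omega_ex (r : R) : {r' | d * r = r' * d}.
Proof.
apply: cid; have /nd[r' _ rE] : [set d * r | r in setT] (d * r) by exists r.
by exists r'.
Qed.

Definition omega (r : R) : R := sval (omega_ex r).

Lemma omegaE (r : R) : d * r = omega r * d.
Proof. exact: svalP (omega_ex r). Qed.

Lemma omega_unique (r r' : R) : d * r = r' * d -> r' = omega r.
Proof. by rewrite omegaE => /rd.2. Qed.

End Omega.

Section OmegaMorphism.

Variables (R : pzRingType) (d : R).

(* [omega] only depends on left normality; the regularity proof is kept as an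
   argument so that the value is a ring endomorphism. *)
Definition omega_end (rd : regular d) (nd : left_normal d) : R -> R := omega nd.

Variables (rd : regular d) (nd : left_normal d).

Fact omega_is_zmod_morphism : zmod_morphism (omega_end rd nd).
Proof.
by move=> x y; apply/esym/(omega_unique rd); rewrite mulrBl mulrBr -!omegaE.
Qed.

Fact omega_is_monoid_morphism : monoid_morphism (omega_end rd nd).
Proof.
split=> [|x y]; apply/esym/(omega_unique rd); first by rewrite mul1r mulr1.
by rewrite -[RHS]mulrA -omegaE mulrA (omegaE nd x) mulrA.
Qed.

HB.instance Definition _ :=
  GRing.isZmodMorphism.Build R R (omega_end rd nd) omega_is_zmod_morphism.
HB.instance Definition _ :=
  GRing.isMonoidMorphism.Build R R (omega_end rd nd) omega_is_monoid_morphism.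

End OmegaMorphism.

(* The ring generated by D, x and y subject to the defining relations: formal
   ring expressions in the elements of D and two letters, modulo the least
   congruence containing the ring axioms, the operations of D and the
   relations of a generalized Weyl algebra. *)
Section GWA.

Variables (D : pzRingType) (sigma tau : {rmorphism D -> D}) (a : D).

Inductive gwa_term : Type :=
| TConst of D
| TX
| TY
| TOpp of gwa_term
| TAdd of gwa_term & gwa_term
| TMul of gwa_term & gwa_term.

Inductive gwa_eq : gwa_term -> gwa_term -> Prop :=
| gwa_refl t : gwa_eq t t
| gwa_sym t u : gwa_eq t u -> gwa_eq u t
| gwa_trans t u v : gwa_eq t u -> gwa_eq u v -> gwa_eq t v
| gwa_congN t t' : gwa_eq t t' -> gwa_eq (TOpp t) (TOpp t')
| gwa_congD t t' u u' :
    gwa_eq t t' -> gwa_eq u u' -> gwa_eq (TAdd t u) (TAdd t' u')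
| gwa_congM t t' u u' :
    gwa_eq t t' -> gwa_eq u u' -> gwa_eq (TMul t u) (TMul t' u')
| gwa_addA t u v : gwa_eq (TAdd t (TAdd u v)) (TAdd (TAdd t u) v)
| gwa_addC t u : gwa_eq (TAdd t u) (TAdd u t)
| gwa_add0 t : gwa_eq (TAdd (TConst 0) t) t
| gwa_addN t : gwa_eq (TAdd (TOpp t) t) (TConst 0)
| gwa_mulA t u v : gwa_eq (TMul t (TMul u v)) (TMul (TMul t u) v)
| gwa_mul1l t : gwa_eq (TMul (TConst 1) t) t
| gwa_mul1r t : gwa_eq (TMul t (TConst 1)) t
| gwa_mulDl t u v : gwa_eq (TMul (TAdd t u) v) (TAdd (TMul t v) (TMul u v))
| gwa_mulDr t u v : gwa_eq (TMul t (TAdd u v)) (TAdd (TMul t u) (TMul t v))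
| gwa_constD d e : gwa_eq (TConst (d + e)) (TAdd (TConst d) (TConst e))
| gwa_constM d e : gwa_eq (TConst (d * e)) (TMul (TConst d) (TConst e))
| gwa_Xd d : gwa_eq (TMul TX (TConst d)) (TMul (TConst (sigma d)) TX)
| gwa_Yd d : gwa_eq (TMul TY (TConst d)) (TMul (TConst (tau d)) TY)
| gwa_YX : gwa_eq (TMul TY TX) (TConst a)
| gwa_XY : gwa_eq (TMul TX TY) (TConst (sigma a)).

HB.instance Definition _ := gen_eqMixin gwa_term.
HB.instance Definition _ := gen_choiceMixin gwa_term.

Definition gwa_rel (t u : gwa_term) : bool := `[< gwa_eq t u >].

Fact gwa_rel_refl : reflexive gwa_rel.
Proof. by move=> t; apply/asboolP; exact: gwa_refl. Qed.

Fact gwa_rel_sym : symmetric gwa_rel.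
Proof. by move=> t u; apply/asboolP/asboolP; exact: gwa_sym. Qed.

Fact gwa_rel_trans : transitive gwa_rel.
Proof.
by move=> u t v /asboolP tu /asboolP uv; apply/asboolP; exact: gwa_trans tu uv.
Qed.

Definition gwa_equiv : equiv_rel gwa_term :=
  EquivRel gwa_rel gwa_rel_refl gwa_rel_sym gwa_rel_trans.

Definition gwa : Type := {eq_quot gwa_equiv}.

HB.instance Definition _ := Choice.on gwa.

Definition gwa_class (t : gwa_term) : gwa := \pi_({eq_quot gwa_equiv}) t.

Definition gwa_repr (z : gwa) : gwa_term := repr (z : {eq_quot gwa_equiv}).

Lemma gwa_classP (t u : gwa_term) : gwa_class t = gwa_class u <-> gwa_eq t u.
Proof.
split=> [/eqquotP /asboolP //|tu].
by apply/eqquotP/asboolP.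
Qed.

Lemma gwa_reprK (z : gwa) : gwa_class (gwa_repr z) = z.
Proof. exact: (@reprK _ {eq_quot gwa_equiv}). Qed.

Lemma gwa_repr_class (t : gwa_term) : gwa_eq (gwa_repr (gwa_class t)) t.
Proof. by apply/gwa_classP; rewrite gwa_reprK. Qed.

Definition gwa_opp (z : gwa) : gwa := gwa_class (TOpp (gwa_repr z)).
Definition gwa_add (z w : gwa) : gwa :=
  gwa_class (TAdd (gwa_repr z) (gwa_repr w)).
Definition gwa_mul (z w : gwa) : gwa :=
  gwa_class (TMul (gwa_repr z) (gwa_repr w)).

Let qoppE t : gwa_opp (gwa_class t) = gwa_class (TOpp t).
Proof. by apply/gwa_classP/gwa_congN/gwa_repr_class. Qed.

Let qaddE t u : gwa_add (gwa_class t) (gwa_class u) = gwa_class (TAdd t u).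
Proof. by apply/gwa_classP/gwa_congD; exact: gwa_repr_class. Qed.

Let qmulE t u : gwa_mul (gwa_class t) (gwa_class u) = gwa_class (TMul t u).
Proof. by apply/gwa_classP/gwa_congM; exact: gwa_repr_class. Qed.

Let gwaW (P : gwa -> Prop) : (forall t, P (gwa_class t)) -> forall z, P z.
Proof. by move=> Pt z; rewrite -[z]gwa_reprK. Qed.

Let qaddA : associative gwa_add.
Proof.
elim/gwaW=> t; elim/gwaW=> u; elim/gwaW=> v.
by rewrite !qaddE; apply/gwa_classP; exact: gwa_addA.
Qed.

Let qaddC : commutative gwa_add.
Proof.
elim/gwaW=> t; elim/gwaW=> u.
by rewrite !qaddE; apply/gwa_classP; exact: gwa_addC.
Qed.

Let qadd0 : left_id (gwa_class (TConst 0)) gwa_add.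
Proof. by elim/gwaW=> t; rewrite qaddE; apply/gwa_classP; exact: gwa_add0. Qed.

Let qaddN : left_inverse (gwa_class (TConst 0)) gwa_opp gwa_add.
Proof.
by elim/gwaW=> t; rewrite qoppE qaddE; apply/gwa_classP; exact: gwa_addN.
Qed.

HB.instance Definition _ := GRing.isZmodule.Build gwa qaddA qaddC qadd0 qaddN.

Let qmulA : associative gwa_mul.
Proof.
elim/gwaW=> t; elim/gwaW=> u; elim/gwaW=> v.
by rewrite !qmulE; apply/gwa_classP; exact: gwa_mulA.
Qed.

Let qmul1l : left_id (gwa_class (TConst 1)) gwa_mul.
Proof. by elim/gwaW=> t; rewrite qmulE; apply/gwa_classP; exact: gwa_mul1l. Qed.

Let qmul1r : right_id (gwa_class (TConst 1)) gwa_mul.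
Proof. by elim/gwaW=> t; rewrite qmulE; apply/gwa_classP; exact: gwa_mul1r. Qed.

Let qmulDl : left_distributive gwa_mul gwa_add.
Proof.
elim/gwaW=> t; elim/gwaW=> u; elim/gwaW=> v.
by rewrite qaddE !qmulE qaddE; apply/gwa_classP; exact: gwa_mulDl.
Qed.

Let qmulDr : right_distributive gwa_mul gwa_add.
Proof.
elim/gwaW=> t; elim/gwaW=> u; elim/gwaW=> v.
by rewrite qaddE !qmulE qaddE; apply/gwa_classP; exact: gwa_mulDr.
Qed.

HB.instance Definition _ :=
  GRing.Zmodule_isPzRing.Build gwa qmulA qmul1l qmul1r qmulDl qmulDr.

Definition gwa_const (d : D) : gwa := gwa_class (TConst d).
Definition gwa_x : gwa := gwa_class TX.
Definition gwa_y : gwa := gwa_class TY.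

Lemma gwa_class_opp t : gwa_class (TOpp t) = - gwa_class t.
Proof. by rewrite -qoppE. Qed.

Lemma gwa_class_add t u : gwa_class (TAdd t u) = gwa_class t + gwa_class u.
Proof. by rewrite -qaddE. Qed.

Lemma gwa_class_mul t u : gwa_class (TMul t u) = gwa_class t * gwa_class u.
Proof. by rewrite -qmulE. Qed.

Fact gwa_const_add : {morph gwa_const : d e / d + e}.
Proof.
by move=> d e; rewrite -gwa_class_add; apply/gwa_classP; exact: gwa_constD.
Qed.

Fact gwa_const_mul : {morph gwa_const : d e / d * e}.
Proof.
by move=> d e; rewrite -gwa_class_mul; apply/gwa_classP; exact: gwa_constM.
Qed.

Fact gwa_const_is_zmod_morphism : zmod_morphism gwa_const.
Proof.
by move=> d e; apply/eqP; rewrite eq_sym subr_eq -gwa_const_add subrK.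
Qed.

Fact gwa_const_is_monoid_morphism : monoid_morphism gwa_const.
Proof. by split; [|exact: gwa_const_mul]. Qed.

HB.instance Definition _ :=
  GRing.isZmodMorphism.Build D gwa gwa_const gwa_const_is_zmod_morphism.
HB.instance Definition _ :=
  GRing.isMonoidMorphism.Build D gwa gwa_const gwa_const_is_monoid_morphism.

Lemma gwa_xd d : gwa_x * gwa_const d = gwa_const (sigma d) * gwa_x.
Proof. by rewrite -!gwa_class_mul; apply/gwa_classP; exact: gwa_Xd. Qed.

Lemma gwa_yd d : gwa_y * gwa_const d = gwa_const (tau d) * gwa_y.
Proof. by rewrite -!gwa_class_mul; apply/gwa_classP; exact: gwa_Yd. Qed.

Lemma gwa_yx : gwa_y * gwa_x = gwa_const a.
Proof. by rewrite -!gwa_class_mul; apply/gwa_classP; exact: gwa_YX. Qed.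

Lemma gwa_xy : gwa_x * gwa_y = gwa_const (sigma a).
Proof. by rewrite -!gwa_class_mul; apply/gwa_classP; exact: gwa_XY. Qed.

Lemma gwa_ind (P : gwa -> Prop) :
  (forall d, P (gwa_const d)) -> P gwa_x -> P gwa_y ->
  (forall z, P z -> P (- z)) ->
  (forall z w, P z -> P w -> P (z + w)) ->
  (forall z w, P z -> P w -> P (z * w)) -> forall z, P z.
Proof.
move=> Pc Px Py PN PD PM; elim/gwaW; elim=> // [t Pt|t Pt u Pu|t Pt u Pu].
- by rewrite gwa_class_opp; apply: PN.
- by rewrite gwa_class_add; apply: PD.
- by rewrite gwa_class_mul; apply: PM.
Qed.

(* Universal property of the presentation. *)
Lemma gwa_lift (B : pzRingType) (f : {rmorphism D -> B}) (X Y : B) :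
  (forall d, X * f d = f (sigma d) * X) ->
  (forall d, Y * f d = f (tau d) * Y) ->
  Y * X = f a -> X * Y = f (sigma a) ->
  exists g : {rmorphism gwa -> B},
    [/\ forall d, g (gwa_const d) = f d, g gwa_x = X & g gwa_y = Y].
Proof.
move=> Xd Yd YX XY.
pose ev := fix ev t := match t with
  | TConst d => f d | TX => X | TY => Y | TOpp t => - ev t
  | TAdd t u => ev t + ev u | TMul t u => ev t * ev u end.
have evP t u : gwa_eq t u -> ev t = ev u.
  elim=> //= {t u}.
  - by move=> t u v _ -> _ ->.
  - by move=> t t' _ ->.
  - by move=> t t' u u' _ -> _ ->.
  - by move=> t t' u u' _ -> _ ->.
  - by move=> t u v; rewrite addrA.
  - by move=> t u; rewrite addrC.
  - by move=> t; rewrite rmorph0 add0r.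
  - by move=> t; rewrite rmorph0 addNr.
  - by move=> t u v; rewrite mulrA.
  - by move=> t; rewrite rmorph1 mul1r.
  - by move=> t; rewrite rmorph1 mulr1.
  - by move=> t u v; rewrite mulrDl.
  - by move=> t u v; rewrite mulrDr.
  - by move=> d e; rewrite rmorphD.
  - by move=> d e; rewrite rmorphM.
pose g z := ev (gwa_repr z).
have gE t : g (gwa_class t) = ev t by apply: evP; exact: gwa_repr_class.
have gB : zmod_morphism g.
  elim/gwaW=> t; elim/gwaW=> u.
  by rewrite -gwa_class_opp -gwa_class_add !gE.
have gM : monoid_morphism g.
  split; first by rewrite gE /= rmorph1.
  by elim/gwaW=> t; elim/gwaW=> u; rewrite -gwa_class_mul !gE.
pose gadd := GRing.isZmodMorphism.Build gwa B g gB.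
pose gmul := GRing.isMonoidMorphism.Build gwa B g gM.
pose G : {rmorphism gwa -> B} := HB.pack g gadd gmul.
by exists G; split=> [d||]; rewrite /= gE.
Qed.

End GWA.

Section IprimeDef.

Variables (D : pzRingType) (sigma tau : {rmorphism D -> D}) (a : D).

(* (i,-i) = sigma^i(a) sigma^(i-1)(a) ... sigma(a) *)
Definition sigma_prod (i : nat) : D := \prod_(j < i) iter (i - j) sigma a.

(* (-i,i) = tau^(i-1)(a) ... tau(a) a *)
Definition tau_prod (i : nat) : D := \prod_(j < i) iter (i - j.+1) tau a.

Definition finite_sums (S : set D) : set D :=
  [set z | exists s : seq D, (forall v, v \in s -> S v) /\ z = \sum_(v <- s) v].

Definition set_DJc (J : set D) (c : D) : set D :=
  finite_sums [set d * u * c | d in setT & u in J].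

Definition set_add (S T : set D) : set D := [set u + v | u in S & v in T].

Definition set_sum_ge1 (F : nat -> set D) : set D :=
  [set z | exists (n : nat) (f : nat -> D),
     (forall i, (1 <= i <= n)%N -> F i (f i)) /\
     z = \sum_(1 <= i < n.+1) f i].

Definition Iprime (I : set D) : set D :=
  set_add I (set_sum_ge1 (fun i =>
    set_add (set_DJc (iter i sigma @` I) (sigma_prod i))
            (set_DJc (iter i tau @` I) (tau_prod i)))).

End IprimeDef.

Definition no_power_is_omega (D : pzRingType) (sigma : {rmorphism D -> D}) :
    Prop :=
  ~ exists (n : nat) (d : D) (rd : regular d) (nd : left_normal d),
      [/\ (1 <= n)%N, sigma d = d & iter n sigma = omega_end rd nd].

(* Main.v *)
Require Import Defs.
From mathcomp Require Import order ssrnum zify.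
Import Order.TTheory GRing.Theory Num.Theory.
Local Open Scope ring_scope.
Local Open Scope classical_set_scope.

(** Write [A] for the algebra, [v k] for [x ^+ k] when [k >= 0] and for
    [y ^+ (- k)] when [k < 0]. Everything rests on the fact that [A] is free
    as a left [D]-module on the [v k], hence graded by the integers.
    Freeness comes from letting [A] act on families [int -> D] by the
    formulas that left multiplication by [d], [x] and [y] must satisfy; the
    three identities assumed on [a] are what makes this compatible with the
    relations. The image of the family concentrated at 0 gives coefficients
    [gwa_coef z k].

    If [A] is simple, the elements killed on the left by a power of [x] form
    a proper ideal, so [x], and likewise [y], is left regular. Then [sigma]
    and [tau] are injective, [a = y x] and [sigma a = x y] are left regular,
    and [tau (sigma a) = a] turns this into right regularity. For an ideal
    [I] of [D], the degree 0 coefficients of the elements of the ideal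
    [A I A] lie in [Iprime I]; as [A I A] contains 1 when [I] is nonzero,
    [Iprime I] is [D]. Finally, if [sigma^n] is the endomorphism given by a
    regular [sigma]-invariant [d], then [w = x ^+ n - d] is normalized by
    [D] and commutes with [x]. It then generates a proper ideal: up to
    powers of [x] on both sides, 1 would be a left multiple [s w] with [s] a
    polynomial in [x], whereas such a product has at least two nonzero
    terms.

    Conversely, let [J] be a nonzero ideal of [A], and take elements of [J]
    supported on a shortest possible interval of degrees, of length [n + 1].
    Multiplying by powers of [x] or [y] moves the interval to [-n .. 0]; the
    coefficients at 0 of the elements of [J] supported there form an ideal
    [T] of [D] that contains [Iprime T], so [T] is [D] and some element [w]
    of [J] has coefficient 1 in degree 0. If [n = 0] then [w = 1]. If
    [n > 0], the element [w x ^+ n] has leading coefficient 1, and by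
    minimality of [n] every expression that cancels one of its extreme terms
    vanishes; this says that its constant coefficient [d] is regular,
    [sigma]-invariant and satisfies [d r = sigma^n(r) d], against the
    assumption on the powers of [sigma].

    Exchanging [(x, sigma, a)] and [(y, tau, sigma a)] gives an isomorphic
    algebra with the same [Iprime], which yields the criterion for [tau]. *)

Set Implicit Arguments.
Unset Strict Implicit.
Unset Printing Implicit Defensive.

(** * The left ideal attached to an ideal of the base ring *)

Section Iprime.

Variables (D : pzRingType) (sigma tau : {rmorphism D -> D}) (a : D).

Record left_ideal (T : set D) : Prop := LeftIdeal {
  left_ideal0 : T 0;
  left_idealD : forall d e, T d -> T e -> T (d + e);
  left_idealM : forall r d, T d -> T (r * d) }.

Lemma left_ideal_sum (T : set D) (m n : nat) (f : nat -> D) :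
  left_ideal T -> (forall i, (m <= i < n)%N -> T (f i)) ->
  T (\sum_(m <= i < n) f i).
Proof.
move=> [T0 TD _] Tf; rewrite big_nat_cond.
by apply: (big_ind T) => // i /andP[/Tf].
Qed.

Lemma left_ideal_finite_sums (S : set D) :
  (forall r d, S d -> S (r * d)) -> left_ideal (finite_sums S).
Proof.
move=> SM; split; first by exists [::]; rewrite big_nil.
- move=> _ _ [s [Ss ->]] [t [St ->]]; exists (s ++ t); rewrite big_cat.
  by split=> // d; rewrite mem_cat => /orP[/Ss|/St].
- move=> r _ [s [Ss ->]]; exists [seq r * d | d <- s].
  rewrite big_map mulr_sumr; split=> // _ /mapP[d ds ->].
  exact/SM/Ss.
Qed.

Lemma left_ideal_DJc (J : set D) c : left_ideal (set_DJc J c).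
Proof.
apply: left_ideal_finite_sums => r _ [d _ [u Ju <-]].
by exists (r * d) => //; exists u; rewrite ?mulrA.
Qed.

Lemma left_ideal_set_add (S T : set D) :
  left_ideal S -> left_ideal T -> left_ideal (set_add S T).
Proof.
move=> [S0 SD SM] [T0 TD TM]; split.
- by exists 0 => //; exists 0; rewrite ?addr0.
- move=> _ _ [s Ss [t Tt <-]] [s' Ss' [t' Tt' <-]].
  exists (s + s'); first exact: SD.
  by exists (t + t'); [exact: TD | rewrite addrACA].
- move=> r _ [s Ss [t Tt <-]].
  exists (r * s); first exact: SM.
  by exists (r * t); [exact: TM | rewrite mulrDr].
Qed.

(** Two sums of different lengths are added after padding both with zeros to a
    common length. *)
Lemma left_ideal_set_sum (F : nat -> set D) :
  (forall i, left_ideal (F i)) -> left_ideal (set_sum_ge1 F).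
Proof.
move=> FI; split.
- by exists 0%N, (fun=> 0); split=> [[]|] //; rewrite big_geq.
- move=> _ _ [m [f [Ff ->]]] [n [g [Fg ->]]].
  pose pad (l : nat) (h : nat -> D) i := if (i <= l)%N then h i else 0.
  exists (maxn m n), (fun i => pad m f i + pad n g i); split=> [i /andP[i1 _]|].
    apply: (left_idealD (FI i)); rewrite /pad; case: ifP => il;
      by [exact: (left_ideal0 (FI i)) | apply: Ff; rewrite i1
         | apply: Fg; rewrite i1].
  rewrite big_split /=; congr (_ + _).
    by rewrite (big_nat_widen _ _ (maxn m n).+1) ?ltnS ?leq_maxl // -big_mkcond.
  by rewrite (big_nat_widen _ _ (maxn m n).+1) ?ltnS ?leq_maxr // -big_mkcond.
- move=> r _ [n [f [Ff ->]]]; exists n, (fun i => r * f i).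
  by rewrite mulr_sumr; split=> // i /Ff; apply: (left_idealM (FI i)).
Qed.

Lemma left_ideal_Iprime I : ideal I -> left_ideal (Iprime sigma tau a I).
Proof.
move=> [I0 ID IMl _]; apply: left_ideal_set_add; first by split.
apply: left_ideal_set_sum => i.
by apply: left_ideal_set_add; apply: left_ideal_DJc.
Qed.

Lemma subset_Iprime (I : set D) : I `<=` Iprime sigma tau a I.
Proof.
move=> d Id; exists d => //; exists 0; rewrite ?addr0 //.
apply: left_ideal0; apply: left_ideal_set_sum => i.
by apply: left_ideal_set_add; apply: left_ideal_DJc.
Qed.

Lemma Iprime_summand I i d : ideal I -> (1 <= i)%N ->
  set_add (set_DJc (iter i sigma @` I) (sigma_prod sigma a i))
          (set_DJc (iter i tau @` I) (tau_prod tau a i)) d ->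
  Iprime sigma tau a I d.
Proof.
move=> idI i1 Fd; exists 0; first exact: ideal0.
exists d; last by rewrite add0r.
exists i, (fun j => if j == i then d else 0); split=> [j _|].
  case: eqP => [->//|_]; apply: left_ideal0.
  by apply: left_ideal_set_add; apply: left_ideal_DJc.
rewrite big_nat_recr //= eqxx big_nat_cond big1 ?add0r // => j.
by rewrite andbT => /andP[_ ji]; rewrite ltn_eqF.
Qed.

Lemma set_DJc_gen (J : set D) c r u : J u -> set_DJc J c (r * u * c).
Proof.
move=> Ju; exists [:: r * u * c]; rewrite big_seq1; split=> // d.
by rewrite inE => /eqP ->; exists r => //; exists u.
Qed.

Lemma Iprime_sigma I i r u : ideal I -> (1 <= i)%N -> I u ->
  Iprime sigma tau a I (r * iter i sigma u * sigma_prod sigma a i).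
Proof.
move=> idI i1 Iu; apply: (Iprime_summand idI i1).
exists (r * iter i sigma u * sigma_prod sigma a i).
  by apply: set_DJc_gen; exists u.
by exists 0; rewrite ?addr0 //; apply: left_ideal0; apply: left_ideal_DJc.
Qed.

Lemma Iprime_tau I i r u : ideal I -> (1 <= i)%N -> I u ->
  Iprime sigma tau a I (r * iter i tau u * tau_prod tau a i).
Proof.
move=> idI i1 Iu; apply: (Iprime_summand idI i1).
exists 0; first by apply: left_ideal0; apply: left_ideal_DJc.
exists (r * iter i tau u * tau_prod tau a i); rewrite ?add0r //.
by apply: set_DJc_gen; exists u.
Qed.

Lemma Iprime_subset (I T : set D) : left_ideal T -> I `<=` T ->
  (forall i u, I u -> T (iter i sigma u * sigma_prod sigma a i)) ->
  (forall i u, I u -> T (iter i tau u * tau_prod tau a i)) ->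
  Iprime sigma tau a I `<=` T.
Proof.
move=> idT IT Ts Tt.
have TDJc (J : set D) c : (forall u, J u -> T (u * c)) -> set_DJc J c `<=` T.
  move=> TJ _ [s [Ss ->]]; rewrite big_seq.
  apply: (big_ind T) => [||d /Ss[r _ [u Ju <-]]]; first exact: left_ideal0.
    exact: left_idealD.
  by rewrite -mulrA; apply/(left_idealM idT)/TJ.
move=> _ [d /IT Td [_ [n [f [Ff ->]]] <-]].
apply: (left_idealD idT) => //.
apply: left_ideal_sum => // i /Ff[s Ss [t St <-]].
apply: (left_idealD idT).
  by apply: (TDJc _ _ _ _ Ss) => _ [u Iu <-]; apply: Ts.
by apply: (TDJc _ _ _ _ St) => _ [u Iu <-]; apply: Tt.
Qed.

End Iprime.

(** The summands indexed by [sigma] and by [tau] trade places, because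
    [tau^(i-j) (sigma a)] is [tau^(i-j-1) a]. *)
Lemma Iprime_swap (D : pzRingType) (sigma tau : {rmorphism D -> D}) (a : D) :
  tau (sigma a) = a ->
  Iprime tau sigma (sigma a) = Iprime sigma tau a.
Proof.
move=> tsa; apply/funext => I; rewrite /Iprime.
congr (set_add I (set_sum_ge1 _)).
apply/funext => i.
have -> : sigma_prod tau (sigma a) i = tau_prod tau a i.
  apply: eq_bigr => j _; have ji := ltn_ord j.
  have -> : (i - j = (i - j.+1).+1)%N by lia.
  by rewrite iterSr tsa.
have -> : tau_prod sigma (sigma a) i = sigma_prod sigma a i.
  apply: eq_bigr => j _; have ji := ltn_ord j.
  have -> : (i - j = (i - j.+1).+1)%N by lia.
  by rewrite iterSr.
apply/seteqP; split=> _ [s Ss [t St <-]];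
  by exists t => //; exists s => //; rewrite addrC.
Qed.

(** * Spanning by the powers of the generators *)

Section Presentation.

Variables (D : pzRingType) (sigma tau : {rmorphism D -> D}) (a : D).

Local Notation A := (gwa sigma tau a).
Local Notation "d %:G" := (gwa_const sigma tau a d)
  (at level 2, left associativity, format "d %:G").
Local Notation x := (gwa_x sigma tau a).
Local Notation y := (gwa_y sigma tau a).

Definition gwa_v (k : int) : A :=
  match k with Posz i => x ^+ i | Negz i => y ^+ i.+1 end.

(** The endomorphism by which a coefficient changes when it crosses [v k]. *)
Definition twist (k : int) (d : D) : D :=
  match k with Posz i => iter i sigma d | Negz i => iter i.+1 tau d end.

Lemma gwa_xid i d : x ^+ i * d%:G = (iter i sigma d)%:G * x ^+ i.
Proof.
elim: i => [|i IH]; first by rewrite !expr0 mul1r mulr1.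
by rewrite exprS -mulrA IH mulrA gwa_xd -mulrA.
Qed.

Lemma gwa_yid i d : y ^+ i * d%:G = (iter i tau d)%:G * y ^+ i.
Proof.
elim: i => [|i IH]; first by rewrite !expr0 mul1r mulr1.
by rewrite exprS -mulrA IH mulrA gwa_yd -mulrA.
Qed.

Lemma gwa_vd k d : gwa_v k * d%:G = (twist k d)%:G * gwa_v k.
Proof. by case: k => i; [exact: gwa_xid | exact: gwa_yid]. Qed.

Lemma gwa_xiyi i : x ^+ i * y ^+ i = (sigma_prod sigma a i)%:G.
Proof.
elim: i => [|i IH]; first by rewrite mul1r /sigma_prod big_ord0 rmorph1.
rewrite exprSr exprS mulrA -[_ * x * y]mulrA gwa_xy gwa_xid -mulrA IH.
rewrite -rmorphM /sigma_prod big_ord_recl subn0 -iterSr; congr (_ * _)%:G.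
Qed.

Lemma gwa_yixi i : y ^+ i * x ^+ i = (tau_prod tau a i)%:G.
Proof.
elim: i => [|i IH]; first by rewrite mul1r /tau_prod big_ord0 rmorph1.
rewrite exprSr exprS mulrA -[_ * y * x]mulrA gwa_yx gwa_yid -mulrA IH.
rewrite -rmorphM /tau_prod big_ord_recl subn1; congr (_ * _)%:G.
Qed.

(** The products of [v k] with [x] and [y], on either side, are multiples of the
    neighbouring [v (k + 1)] and [v (k - 1)]; a factor other than 1 appears when
    the step goes towards degree 0. *)
Lemma gwa_xv k :
  x * gwa_v k = (if 0 <= k then 1 else sigma a)%:G * gwa_v (k + 1).
Proof.
case: k => [i|[|i]].
- have -> : Posz i + 1 = Posz i.+1 by lia.
  by rewrite /= rmorph1 mul1r exprS.
- by rewrite /= expr1 mulr1 gwa_xy.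
- have -> : Negz i.+1 + 1 = Negz i by lia.
  by rewrite /= [y ^+ _]exprS mulrA gwa_xy.
Qed.

Lemma gwa_yv k :
  y * gwa_v k = (if k <= 0 then 1 else a)%:G * gwa_v (k - 1).
Proof.
case: k => [[|i]|i].
- by rewrite /= mulr1 rmorph1 mul1r expr1.
- have -> : Posz i.+1 - 1 = Posz i by lia.
  by rewrite /= exprS mulrA gwa_yx.
- have -> : Negz i - 1 = Negz i.+1 by lia.
  by rewrite /= rmorph1 mul1r [RHS]exprS.
Qed.

Lemma gwa_vx k :
  gwa_v k * x
  = (if 0 <= k then 1 else iter (`|k|.-1) tau a)%:G * gwa_v (k + 1).
Proof.
case: k => [i|[|i]].
- have -> : Posz i + 1 = Posz i.+1 by lia.
  by rewrite /= rmorph1 mul1r exprSr.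
- by rewrite /= expr1 mulr1 gwa_yx.
- have -> : Negz i.+1 + 1 = Negz i by lia.
  by rewrite /= [y ^+ _]exprSr -mulrA gwa_yx gwa_yid.
Qed.

Lemma gwa_vy k :
  gwa_v k * y
  = (if k <= 0 then 1 else iter `|k| sigma a)%:G * gwa_v (k - 1).
Proof.
case: k => [[|i]|i].
- by rewrite /= rmorph1 !mul1r expr1.
- have -> : Posz i.+1 - 1 = Posz i by lia.
  by rewrite absz_nat /= exprSr -mulrA gwa_xy gwa_xid -iterSr.
- have -> : Negz i - 1 = Negz i.+1 by lia.
  by rewrite /= rmorph1 mul1r [RHS]exprSr.
Qed.

(** The additive span [T] of the [d v_k] contains 1 and is stable under left
    multiplication by [D], [x] and [y], so it is everything.  It is encoded
    impredicatively, as the least additive predicate holding on the [d v_k]. *)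
Lemma gwa_span_ind (P : A -> Prop) :
  (forall d k, P (d%:G * gwa_v k)) ->
  (forall z w, P z -> P w -> P (z + w)) -> forall z, P z.
Proof.
move=> Pv PD z.
pose T u := forall Q : A -> Prop, (forall d k, Q (d%:G * gwa_v k)) ->
  (forall z w, Q z -> Q w -> Q (z + w)) -> Q u.
suff TM : forall z u, T u -> T (z * u).
  have /(TM z) : T 1 by move=> Q Qv _; have := Qv 1 0; rewrite rmorph1 mulr1.
  by rewrite mulr1 => Tz; exact: (Tz P).
move=> {}z {P Pv PD}.
elim/gwa_ind: z => [e|||z IH|z w IHz IHw|z w IHz IHw] u Tu.
- move=> Q Qv QD; apply: (Tu (fun u => Q (e%:G * u))) => [d k|z w].
    by rewrite mulrA -rmorphM; exact: Qv.
  by rewrite mulrDr; apply: QD.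
- move=> Q Qv QD; apply: (Tu (fun u => Q (x * u))) => [d k|z w].
    by rewrite mulrA gwa_xd -mulrA gwa_xv mulrA -rmorphM; exact: Qv.
  by rewrite mulrDr; apply: QD.
- move=> Q Qv QD; apply: (Tu (fun u => Q (y * u))) => [d k|z w].
    by rewrite mulrA gwa_yd -mulrA gwa_yv mulrA -rmorphM; exact: Qv.
  by rewrite mulrDr; apply: QD.
- have /IH : T (- u).
    move=> Q Qv QD; apply: (Tu (fun u => Q (- u))) => [d k|z' w].
      by rewrite -mulNr -rmorphN; exact: Qv.
    by rewrite opprD; apply: QD.
  by rewrite mulrN mulNr.
- by move=> Q Qv QD; rewrite mulrDl; apply: (QD); [exact: IHz|exact: IHw].
- by rewrite -mulrA; exact: (IHz _ (IHw _ Tu)).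
Qed.

End Presentation.

(** * Coefficients *)

Section Coefficients.

Variables (D : pzRingType) (sigma tau : {rmorphism D -> D}) (a : D).
Hypotheses (tau_sigma_a : tau (sigma a) = a)
  (a_comm : forall d : D, a * d = tau (sigma d) * a)
  (sigma_a_comm : forall d : D, sigma a * d = sigma (tau d) * sigma a).

Local Notation A := (gwa sigma tau a).
Local Notation "d %:G" := (gwa_const sigma tau a d)
  (at level 2, left associativity, format "d %:G").
Local Notation x := (gwa_x sigma tau a).
Local Notation y := (gwa_y sigma tau a).
Local Notation v := (gwa_v sigma tau a).

(** Left multiplication by [t] in a free module on the [v k], read on families
    of coefficients: the formulas for [x] and [y] are forced by [gwa_xv] and
    [gwa_yv]. *)
Fixpoint term_act (t : gwa_term D) (f : int -> D) : int -> D :=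
  match t with
  | TConst d => fun k => d * f k
  | TX => fun k => sigma (f (k - 1) * if 0 < k then 1 else a)
  | TY => fun k => tau (f (k + 1)) * if k < 0 then 1 else a
  | TOpp u => fun k => - term_act u f k
  | TAdd u w => fun k => term_act u f k + term_act w f k
  | TMul u w => term_act u (term_act w f)
  end.

Lemma term_actD t f g :
  term_act t (fun k => f k + g k) = fun k => term_act t f k + term_act t g k.
Proof.
elim: t f g => [d|||t IH|t IHt u IHu|t IHt u IHu] f g /=.
- by apply/funext => k; rewrite mulrDr.
- by apply/funext => k; rewrite mulrDl rmorphD.
- by apply/funext => k; rewrite rmorphD mulrDl.
- by apply/funext => k; rewrite IH opprD.
- by apply/funext => k; rewrite IHt IHu addrACA.
- by rewrite IHu IHt.
Qed.

(** The action respects the congruence: additivity gives right distributivity,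
    and the relations for [y x] and [x y] follow from the commutation rules of
    [a] and [sigma a] with [D], the value [tau (sigma a) = a] being used in
    negative degrees. *)
Lemma term_act_eq t u : gwa_eq sigma tau a t u -> term_act t = term_act u.
Proof.
elim=> //= {t u}.
- by move=> t u v _ -> _ ->.
- by move=> t t' _ ->.
- by move=> t t' u u' _ -> _ ->.
- by move=> t t' u u' _ -> _ ->.
- by move=> t u v; apply/funext => f; apply/funext => k; rewrite addrA.
- by move=> t u; apply/funext => f; apply/funext => k; rewrite addrC.
- by move=> t; apply/funext => f; apply/funext => k; rewrite mul0r add0r.
- by move=> t; apply/funext => f; apply/funext => k; rewrite mul0r addNr.
- by move=> t; apply/funext => f; apply/funext => k; rewrite mul1r.
- move=> t; apply/funext => f; congr (term_act t _).
  by apply/funext => k; rewrite mul1r.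
- by move=> t u v; apply/funext => f; rewrite term_actD.
- by move=> d e; apply/funext => f; apply/funext => k; rewrite mulrDl.
- by move=> d e; apply/funext => f; apply/funext => k; rewrite mulrA.
- by move=> d; apply/funext => f; apply/funext => k; rewrite -mulrA rmorphM.
- by move=> d; apply/funext => f; apply/funext => k; rewrite rmorphM mulrA.
- apply/funext => f; apply/funext => k; rewrite addrK a_comm.
  have [k0|k0] := ltP k 0.
    by rewrite ifF ?mulr1 ?rmorphM ?tau_sigma_a //; lia.
  by rewrite ifT ?mulr1 //; lia.
- apply/funext => f; apply/funext => k; rewrite subrK sigma_a_comm.
  have [k0|k0] := ltP 0 k.
    by rewrite ifF ?mulr1 ?rmorphM //; lia.
  by rewrite ifT ?mulr1 ?rmorphM //; lia.
Qed.

Definition gwa_act (z : A) : (int -> D) -> (int -> D) := term_act (gwa_repr z).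

Lemma gwa_act_class t : gwa_act (gwa_class sigma tau a t) = term_act t.
Proof. exact/term_act_eq/gwa_repr_class. Qed.

(** The family concentrated at 0 stands for [v 0 = 1]. *)
Definition gwa_coef (z : A) (k : int) : D :=
  gwa_act z (fun j => (j == 0)%:R) k.

Lemma coefD z w k : gwa_coef (z + w) k = gwa_coef z k + gwa_coef w k.
Proof.
rewrite /gwa_coef -[z]gwa_reprK -[w]gwa_reprK -gwa_class_add.
by rewrite !gwa_act_class.
Qed.

Lemma coefN z k : gwa_coef (- z) k = - gwa_coef z k.
Proof. by rewrite /gwa_coef -[z]gwa_reprK -gwa_class_opp !gwa_act_class. Qed.

Lemma coefB z w k : gwa_coef (z - w) k = gwa_coef z k - gwa_coef w k.
Proof. by rewrite coefD coefN. Qed.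

Lemma gwa_actM z w f : gwa_act (z * w) f = gwa_act z (gwa_act w f).
Proof.
rewrite -[z]gwa_reprK -[w]gwa_reprK -gwa_class_mul.
by rewrite !gwa_act_class.
Qed.

Lemma coef_dM d z k : gwa_coef (d%:G * z) k = d * gwa_coef z k.
Proof. by rewrite /gwa_coef gwa_actM gwa_act_class. Qed.

Lemma coef_xM z k :
  gwa_coef (x * z) k = sigma (gwa_coef z (k - 1) * if 0 < k then 1 else a).
Proof. by rewrite /gwa_coef gwa_actM gwa_act_class. Qed.

Lemma coef_yM z k :
  gwa_coef (y * z) k = tau (gwa_coef z (k + 1)) * if k < 0 then 1 else a.
Proof. by rewrite /gwa_coef gwa_actM gwa_act_class. Qed.

Lemma coef_v j k : gwa_coef (v j) k = (k == j)%:R.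
Proof.
have coef1 i : gwa_coef 1 i = (i == 0)%:R.
  by rewrite /gwa_coef gwa_act_class /= mul1r.
case: j => i /=.
  elim: i k => [|i IH] k; first by rewrite expr0 coef1.
  rewrite exprS coef_xM IH.
  have [/eqP ->|ki] := boolP (k == Posz i.+1).
    have -> : Posz i.+1 - 1 = Posz i by lia.
    by rewrite eqxx mulr1 rmorph1.
  by rewrite (_ : _ == _ = false) ?mul0r ?rmorph0 //; lia.
elim: i k => [|i IH] k.
  rewrite expr1 -[y]mulr1 coef_yM coef1.
  have [/eqP ->|ki] := boolP (k == Negz 0); first by rewrite /= rmorph1 mulr1.
  by rewrite (_ : _ == _ = false) ?rmorph0 ?mul0r //; lia.
rewrite exprS coef_yM IH.
have [/eqP ->|ki] := boolP (k == Negz i.+1).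
  have -> : Negz i.+1 + 1 = Negz i by lia.
  by rewrite eqxx mulr1 rmorph1.
by rewrite (_ : _ == _ = false) ?rmorph0 ?mul0r //; lia.
Qed.

Lemma coef_dv d j k : gwa_coef (d%:G * v j) k = d * (k == j)%:R.
Proof. by rewrite coef_dM coef_v. Qed.

Lemma coef_d d k : gwa_coef d%:G k = d * (k == 0)%:R.
Proof. by rewrite -coef_dv mulr1. Qed.

Lemma coef0 k : gwa_coef 0 k = 0.
Proof. by rewrite -(subrr (0 : A)) coefB subrr. Qed.

Lemma coef_Md z d k :
  gwa_coef (z * d%:G) k = gwa_coef z k * twist sigma tau k d.
Proof.
elim/gwa_span_ind: z => [e j|z w IHz IHw].
  rewrite -mulrA gwa_vd mulrA -rmorphM !coef_dv.
  by have [->|] := eqVneq k j; rewrite ?mulr1 // !mulr0 mul0r.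
by rewrite mulrDl !coefD IHz IHw mulrDl.
Qed.

Lemma coef_Mx z k :
  gwa_coef (z * x) k
  = gwa_coef z (k - 1) * if 0 < k then 1 else iter `|k| tau a.
Proof.
elim/gwa_span_ind: z => [e j|z w IHz IHw].
  rewrite -mulrA gwa_vx mulrA -rmorphM !coef_dv subr_eq.
  have [->|] := eqVneq k (j + 1); last by rewrite !mulr0 mul0r.
  by rewrite !mulr1; congr (_ * _); do 2 case: ifP; try (by []); try lia;
    move=> *; congr iter; lia.
by rewrite mulrDl !coefD IHz IHw mulrDl.
Qed.

Lemma coef_My z k :
  gwa_coef (z * y) k
  = gwa_coef z (k + 1) * if k < 0 then 1 else iter `|k + 1| sigma a.
Proof.
elim/gwa_span_ind: z => [e j|z w IHz IHw].
  rewrite -mulrA gwa_vy mulrA -rmorphM !coef_dv -subr_eq opprK.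
  have [/eqP|] := boolP (k + 1 == j); last by rewrite !mulr0 mul0r.
  by move=> <-; rewrite !mulr1; congr (_ * _); do 2 case: ifP; try (by []); lia.
by rewrite mulrDl !coefD IHz IHw mulrDl.
Qed.

Lemma coef_finite z :
  exists N : nat, forall k, (N < `|k|)%N -> gwa_coef z k = 0.
Proof.
elim/gwa_span_ind: z => [d j|z w [M zM] [N wN]].
  by exists `|j|%N => k jk; rewrite coef_dv (_ : _ == _ = false) ?mulr0 //; lia.
by exists (maxn M N) => k kMN; rewrite coefD zM ?wN ?addr0 //; lia.
Qed.

(** Each element is recovered from its coefficients as the sum of the
    [gwa_coef z k * v k] over a large enough interval of degrees; by additivity
    this is checked on the [d v_j]. *)
Lemma coef_inj z : (forall k, gwa_coef z k = 0) -> z = 0.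
Proof.
pose degree (N : nat) (i : 'I_N.*2.+1) : int := Posz i - Posz N.
pose rebuild N u : A :=
  \sum_(i < N.*2.+1) (gwa_coef u (degree N i))%:G * v (degree N i).
suff [N /(_ _ (leqnn N)) zE] :
    exists N, forall M, (N <= M)%N -> rebuild M z = z.
  by move=> z0; rewrite -zE /rebuild big1 // => i _; rewrite z0 rmorph0 mul0r.
elim/gwa_span_ind: z => [d j|z w [M zM] [N wN]].
  exists `|j|%N => M jM; rewrite /rebuild.
  have iP : (absz (j + Posz M)%R < M.*2.+1)%N by lia.
  have iE : degree M (Ordinal iP) = j by rewrite /degree /=; lia.
  rewrite (bigD1 (Ordinal iP)) //= iE coef_dv eqxx mulr1 big1 ?addr0 // => i.
  move=> /eqP i_neq.
  rewrite coef_dv (_ : _ == _ = false) ?mulr0 ?rmorph0 ?mul0r //.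
  apply/negP => /eqP ij; apply/i_neq/val_inj => /=.
  by move: ij; rewrite /degree; lia.
exists (maxn M N) => K; rewrite geq_max => /andP[MK NK].
rewrite -{2}(zM _ MK) -{2}(wN _ NK) /rebuild -big_split.
by apply: eq_bigr => i _; rewrite coefD rmorphD mulrDl.
Qed.

(** Since [v j] shifts degrees by [j], vanishing of coefficients is carried
    along. Stated for one degree at a time, this transports any support
    condition. *)
Lemma coef_vM_eq0 j z k : gwa_coef z k = 0 -> gwa_coef (v j * z) (j + k) = 0.
Proof.
case: j => i /= zk; elim: i => [|i IH].
- by rewrite mul1r add0r.
- rewrite exprS -mulrA coef_xM (_ : _ - 1 = Posz i + k); last by lia.
  by rewrite IH mul0r rmorph0.
- by rewrite expr1 coef_yM (_ : _ + 1 = k) ?zk ?rmorph0 ?mul0r //; lia.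
- rewrite exprS -mulrA coef_yM (_ : _ + 1 = Negz i + k); last by lia.
  by rewrite IH rmorph0 mul0r.
Qed.

Lemma coef_Mv_eq0 j z k : gwa_coef z k = 0 -> gwa_coef (z * v j) (k + j) = 0.
Proof.
case: j => i /= zk; elim: i => [|i IH].
- by rewrite mulr1 addr0.
- rewrite exprSr mulrA coef_Mx (_ : _ - 1 = k + Posz i); last by lia.
  by rewrite IH mul0r.
- by rewrite expr1 coef_My (_ : _ + 1 = k) ?zk ?mul0r //; lia.
- rewrite exprSr mulrA coef_My (_ : _ + 1 = k + Negz i); last by lia.
  by rewrite IH mul0r.
Qed.

Lemma coef_vMv_eq0 i j z k :
  gwa_coef z k = 0 -> gwa_coef (v i * z * v j) (i + k + j) = 0.
Proof. by move=> zk; apply/coef_Mv_eq0/coef_vM_eq0. Qed.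

Lemma gwa_const_inj d : d%:G = 0 -> d = 0.
Proof. by move=> d0; rewrite -[d]mulr1 -(coef_d d 0) d0 coef0. Qed.

Lemma coef_vdv k d :
  gwa_coef (v k * d%:G * v (- k)) 0
  = twist sigma tau k d
    * match k with Posz i => sigma_prod sigma a i
                 | Negz i => tau_prod tau a i.+1 end.
Proof.
rewrite gwa_vd -mulrA coef_dM; congr (_ * _).
case: k => [[|i]|i].
- have -> : v (Posz 0) * v (- Posz 0) = v (Posz 0) by rewrite oppr0 mulr1.
  by rewrite coef_v /sigma_prod big_ord0.
- by rewrite -NegzE [v _]/= gwa_xiyi coef_d mulr1.
- have -> : - Negz i = Posz i.+1 by lia.
  by rewrite [v _]/= gwa_yixi coef_d mulr1.
Qed.

Lemma coef_vMv k z :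
  gwa_coef (v k * z * v (- k)) 0
  = gwa_coef (v k * (gwa_coef z 0)%:G * v (- k)) 0.
Proof.
apply/eqP; rewrite -subr_eq0 -coefB -mulrBl -mulrBr.
have := @coef_vMv_eq0 k (- k) (z - (gwa_coef z 0)%:G) 0.
by rewrite addr0 subrr coefB coef_d mulr1 subrr => /(_ erefl) ->.
Qed.

Lemma Iprime_component I k r u : ideal I -> I u ->
  Iprime sigma tau a I (r * gwa_coef (v k * u%:G * v (- k)) 0).
Proof.
move=> idI Iu; rewrite coef_vdv mulrA; case: k => [[|i]|i].
- rewrite /sigma_prod big_ord0 mulr1.
  by apply: subset_Iprime; apply: idealMl.
- exact: Iprime_sigma.
- exact: Iprime_tau.
Qed.

Lemma coef_Mxn s n k : (forall j, j < 0 -> gwa_coef s j = 0) ->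
  gwa_coef (s * x ^+ n) k = gwa_coef s (k - Posz n).
Proof.
move=> s0; elim: n k => [|n IH] k; first by rewrite mulr1 subr0.
have kE : k - 1 - Posz n = k - Posz n.+1 by lia.
rewrite exprSr mulrA coef_Mx IH kE.
by case: ifP => k0; rewrite ?mulr1 // s0 ?mul0r //; lia.
Qed.

(** * Consequences of simplicity *)

(** A right ideal [K] stable under [D] and [x] on the left becomes two-sided
    after saturation by powers of [x]: left multiplication by [y] is
    absorbed as [x ^+ m.+1 y = sigma^(m+1)(a) x ^+ m]. *)
Lemma sat_ideal (K : set A) :
  K 0 -> (forall z w, K z -> K w -> K (z + w)) ->
  (forall z q, K z -> K (z * q)) -> (forall d z, K z -> K (d%:G * z)) ->
  (forall z, K z -> K (x * z)) ->
  ideal [set z | exists m, K (x ^+ m * z)].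
Proof.
move=> K0 KD KM Kd Kx.
have Kxi i z : K z -> K (x ^+ i * z).
  by move=> Kz; elim: i => [|i IH]; rewrite ?mul1r // exprS -mulrA; apply: Kx.
have L0 : [set z | exists m, K (x ^+ m * z)] 0 by exists 0%N; rewrite mulr0.
have LD z w : (exists m, K (x ^+ m * z)) -> (exists m, K (x ^+ m * w)) ->
    exists m, K (x ^+ m * (z + w)).
  move=> [m Km] [n Kn]; exists (m + n)%N; rewrite mulrDr; apply: (KD).
    by rewrite addnC exprD -mulrA; apply: Kxi.
  by rewrite exprD -mulrA; apply: Kxi.
split=> // [r z|r z [m Km]]; last by exists m; rewrite mulrA; apply: KM.
elim/gwa_ind: r z => [d|||r IH|r s IHr IHs|r s IHr IHs] z /=.
- by move=> [m Km]; exists m; rewrite mulrA gwa_xid -mulrA; apply: Kd.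
- by move=> [m Km]; exists m; rewrite mulrA -exprSr exprS -mulrA; apply: Kx.
- move=> [m Km]; exists m.+1.
  rewrite exprSr -!mulrA (mulrA x) gwa_xy mulrA gwa_xid -mulrA.
  exact: Kd.
- move=> /IH[m Km]; exists m.
  by rewrite mulNr mulrN -mulrN1; apply: KM.
- by move=> Lz; rewrite mulrDl; apply: LD; [apply: IHr|apply: IHs].
- by move=> Lz; rewrite -mulrA; apply/IHr/IHs.
Qed.

Section SimpleImplies.

Hypothesis simpleA : simple_ring A.

Lemma const_neq0 : (1 : D) <> 0.
Proof.
move=> D0; apply: simpleA.1.
by rewrite -[1](@rmorph1 _ _ (gwa_const sigma tau a)) D0 rmorph0.
Qed.

Lemma expx_neq0 n : x ^+ n <> 0.
Proof.
move=> xn0; apply: const_neq0.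
by have := coef_v n n; rewrite eqxx /= xn0 coef0.
Qed.

Lemma simple_proper_ideal (K : set A) z : ideal K -> ~ K 1 -> K z -> z = 0.
Proof.
move=> idK K1 Kz; case: (simpleA.2 _ idK) => KE; first by move: Kz; rewrite KE.
by case: K1; rewrite KE.
Qed.

(** The elements killed by some [x ^+ m] on the left form an ideal, which is
    proper because [x ^+ m] has coefficient 1 in degree [m]. *)
Lemma simple_x_lreg z : x * z = 0 -> z = 0.
Proof.
move=> xz; have idL : ideal [set z | exists m, x ^+ m * z = 0].
  apply: (@sat_ideal [set 0]) => //= [z' w -> ->|z' q ->|d z' ->|z' ->] //;
    by rewrite ?addr0 ?mulr0 ?mul0r.
apply: (simple_proper_ideal idL).
  by move=> [m]; rewrite mulr1; apply: expx_neq0.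
by exists 1%N.
Qed.

(** Right regularity of [a] follows from the left one: if [d a = 0], then
    [a d = tau (sigma d) * a = tau (sigma (d * a)) = 0]. *)
Lemma simple_regular :
  (forall z, y * z = 0 -> z = 0) ->
  [/\ regular a, regular (sigma a), injective sigma & injective tau].
Proof.
move=> y_lreg.
have sigma_inj : injective sigma.
  apply: raddf_inj => d sd; apply/gwa_const_inj/simple_x_lreg.
  by rewrite gwa_xd sd rmorph0 mul0r.
have tau_inj : injective tau.
  apply: raddf_inj => d td; apply/gwa_const_inj/y_lreg.
  by rewrite gwa_yd td rmorph0 mul0r.
have a_lreg d : a * d = 0 -> d = 0.
  move=> ad; apply/gwa_const_inj/simple_x_lreg/y_lreg.
  by rewrite mulrA gwa_yx -rmorphM ad rmorph0.
have sa_lreg d : sigma a * d = 0 -> d = 0.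
  move=> ad; apply/gwa_const_inj/y_lreg/simple_x_lreg.
  by rewrite mulrA gwa_xy -rmorphM ad rmorph0.
split=> //; split; [exact: mulrI0_lreg| |exact: mulrI0_lreg|].
- apply: mulIr0_rreg => d da; apply: a_lreg.
  by rewrite a_comm -[X in _ * X]tau_sigma_a -!rmorphM da !rmorph0.
- apply: mulIr0_rreg => d da; apply: sa_lreg.
  by rewrite sigma_a_comm -[X in _ * sigma X]tau_sigma_a -!rmorphM da !rmorph0.
Qed.

(** The degree 0 coefficients of the ideal generated by [I] lie in
    [Iprime I]. It is convenient to replace that ideal by the larger ideal
    [K] of the elements all of whose multiples have their degree 0
    coefficient in [Iprime I]. *)
Lemma simple_Iprime I : ideal I -> I <> [set 0] -> Iprime sigma tau a I = setT.
Proof.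
move=> idI I0.
have [u Iu u0] : exists2 u, I u & u <> 0.
  apply: contrapT => noU; apply: I0; apply/seteqP; split=> [u Iu|_ ->].
    by apply: contrapT => u0; apply: noU; exists u.
  exact: ideal0.
have [I'0 I'D I'M] := left_ideal_Iprime sigma tau a idI.
pose K : set A :=
  [set z | forall p q, Iprime sigma tau a I (gwa_coef (p * z * q) 0)].
have idK : ideal K.
  split=> [p q|z w Kz Kw p q|r z Kz p q|r z Kz p q].
  - by rewrite mulr0 mul0r coef0.
  - by rewrite mulrDr mulrDl coefD; apply: I'D.
  - by rewrite mulrA; apply: Kz.
  - by rewrite mulrA -mulrA; apply: Kz.
have Ku : K u%:G.
  move=> p q; elim/gwa_span_ind: p => [r j|p p' IHp IHp']; last first.
    by rewrite !mulrDl coefD; apply: I'D.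
  elim/gwa_span_ind: q => [s k|q q' IHq IHq']; last first.
    by rewrite mulrDr coefD; apply: I'D.
  have -> : r%:G * v j * u%:G * (s%:G * v k) = r%:G * (v j * (u * s)%:G * v k).
    by rewrite rmorphM !mulrA.
  rewrite coef_dM; have [->|jk] := eqVneq k (- j).
    by apply: Iprime_component => //; apply: idealMr.
  have := @coef_vMv_eq0 j k (u * s)%:G (- j - k).
  rewrite (_ : j + _ + k = 0); last by lia.
  rewrite coef_d (_ : _ == _ = false) ?mulr0 => [->//|]; last by lia.
  by rewrite mulr0.
have KT : K = setT.
  case: (simpleA.2 _ idK) => // KE; case: u0; apply: gwa_const_inj.
  by move: Ku; rewrite KE.
have I'1 : Iprime sigma tau a I 1.
  have : K 1 by rewrite KT.
  by move=> /(_ 1 1); rewrite !mulr1 (coef_v 0 0).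
by apply/seteqP; split=> // d _; rewrite -[d]mulr1; apply: I'M.
Qed.

(** If [sigma^n] is given by [d], then [w = x ^+ n - d] generates a proper
    nonzero ideal. Let [Sw] be the set of left multiples [s w] with [s]
    supported in nonnegative degrees, and [K] the right ideal of the [z] all
    of whose right multiples fall into [Sw] after right multiplication by a
    power of [x]. If the saturation of [K] by powers of [x] contained 1,
    some [x ^+ N] would be [s w] in [Sw]. Comparing coefficients in degree
    [j] gives [s_(j-n) - s_j d = (j == N)], which forces [s = 0]: below [N]
    by increasing induction, as [d] is regular, and from [N] on by
    decreasing induction, as [s] has finite support. *)
Lemma simple_no_power_is_omega : no_power_is_omega sigma.
Proof.
move=> [n [d [rd [nd [n1 sd E]]]]].
have dr r : d * r = iter n sigma r * d by rewrite E; apply: omegaE.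
have twd i : iter i sigma d = d by elim: i => //= i ->.
pose w : A := x ^+ n - d%:G.
have wx : w * x = x * w.
  by rewrite mulrBl mulrBr -exprSr -exprS gwa_xd sd.
have wxi i : w * x ^+ i = x ^+ i * w.
  elim: i => [|i IH]; first by rewrite mulr1 mul1r.
  by rewrite exprS mulrA wx -mulrA IH mulrA.
have wr r : w * r%:G = (iter n sigma r)%:G * w.
  by rewrite mulrBl mulrBr gwa_xid -!rmorphM dr.
pose nonneg (s : A) := forall k, k < 0 -> gwa_coef s k = 0.
have nonnegMx s : nonneg s -> nonneg (s * x).
  by move=> s0 k k0; rewrite coef_Mx s0 ?mul0r //; lia.
pose Sw : set A := [set z | exists2 s, nonneg s & z = s * w].
have Sw0 : Sw 0 by exists 0; [move=> k _; exact: coef0 | rewrite mul0r].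
have SwD z t : Sw z -> Sw t -> Sw (z + t).
  move=> [s s0 ->] [s' s0' ->]; exists (s + s'); rewrite ?mulrDl //.
  by move=> k k0; rewrite coefD s0 ?s0' ?addr0.
have SwMxi z i : Sw z -> Sw (z * x ^+ i).
  move=> [s s0 ->]; exists (s * x ^+ i); last by rewrite -!mulrA wxi.
  by elim: i => [|i IH]; rewrite ?mulr1 // exprSr mulrA; apply: nonnegMx.
have Swd r z : Sw z -> Sw (r%:G * z).
  move=> [s s0 ->]; exists (r%:G * s); rewrite ?mulrA // => k k0.
  by rewrite coef_dM s0 ?mulr0.
have SwxM z : Sw z -> Sw (x * z).
  move=> [s s0 ->]; exists (x * s); rewrite ?mulrA // => k k0.
  by rewrite coef_xM s0 ?mul0r ?rmorph0 //; lia.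
pose K : set A := [set z | forall q, exists i, Sw (z * q * x ^+ i)].
have idL : ideal [set z | exists m, K (x ^+ m * z)].
  apply: sat_ideal => [q|z t Kz Kt q|z r Kz q|r z Kz q|z Kz q].
  - by exists 0%N; rewrite !mul0r.
  - have [[i Si] [j Sj]] := (Kz q, Kt q); exists (i + j)%N.
    rewrite !mulrDl; apply: SwD; first by rewrite exprD mulrA; apply: SwMxi.
    by rewrite addnC exprD mulrA; apply: SwMxi.
  - by have [i Si] := Kz (r * q); exists i; rewrite -(mulrA z).
  - have [i Si] := Kz q; exists i.
    by rewrite -!mulrA; apply: Swd; rewrite mulrA.
  - have [i Si] := Kz q; exists i.
    by rewrite -!mulrA; apply: SwxM; rewrite mulrA.
have Kw : K w.
  move=> q; elim/gwa_span_ind: q => [r [i|i]|q q' [i Si] [j Sj]].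
  - exists 0%N; rewrite mulr1 mulrA wr -mulrA [v _]/= wxi.
    apply: Swd; exists (x ^+ i) => // k k0.
    by rewrite (coef_v i k) lt_eqF //; lia.
  (* x ^+ i.+1 on the right turns y ^+ i.+1 into an element of D *)
  - exists i.+1; rewrite -!mulrA [v _]/= gwa_yixi -rmorphM wr.
    apply: Swd; exists 1; rewrite ?mul1r // => k k0.
    by rewrite (coef_v 0 k) lt_eqF.
  - exists (i + j)%N; rewrite mulrDr mulrDl; apply: SwD.
      by rewrite exprD mulrA; apply: SwMxi.
    by rewrite addnC exprD mulrA; apply: SwMxi.
have w0 : w = 0.
  apply: (simple_proper_ideal idL); last by exists 0%N; rewrite mul1r.
  move=> [m /(_ 1)[k [s s0]]]; rewrite !mulr1 -exprD; set N := (m + k)%N => sE.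
  have coef_s (j : nat) :
      gwa_coef s (Posz j - Posz n) - gwa_coef s j * d = (j == N)%:R.
    have := coef_v N j; rewrite [v _]/= sE mulrBr coefB coef_Mxn // coef_Md.
    by rewrite [twist _ _ _ _]/= twd.
  have s_low (j : nat) : (j < N)%N -> gwa_coef s j = 0.
    elim/ltn_ind: j => j IH jN; apply: rd.2; rewrite mul0r.
    have := coef_s j; rewrite (ltn_eqF jN).
    have -> : gwa_coef s (Posz j - Posz n) = 0.
      have [jn|nj] := ltnP j n; first by apply: s0; lia.
      by rewrite subzn //; apply: IH; lia.
    by rewrite sub0r => /eqP; rewrite oppr_eq0 => /eqP.
  have [B sB] := coef_finite s.
  have s_high t (j : nat) : (N <= j)%N -> (B < j + t)%N -> gwa_coef s j = 0.
    elim: t j => [|t IH] j Nj Bj; first by apply: sB; rewrite absz_nat; lia.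
    have := coef_s (j + n)%N.
    rewrite PoszD addrK (_ : (_ + _ == N)%N = false); last by lia.
    by rewrite -PoszD (IH (j + n)%N) ?mul0r ?subr0 //; lia.
  apply: (expx_neq0 (n := N)); rewrite sE.
  suff -> : s = 0 by rewrite mul0r.
  apply: coef_inj => -[j|j]; last exact: s0.
  by have [/s_low|/s_high/(_ (ltn_addl j (ltnSn B)))] := ltnP j N.
apply: const_neq0.
have := coef_v n n; rewrite eqxx => /esym xn; apply: etrans xn _.
rewrite [v _]/= -[x ^+ n](subrK d%:G) -/w w0 add0r coef_d.
by rewrite (_ : _ == _ = false) ?mulr0 //; lia.
Qed.

End SimpleImplies.

(** * Elements of minimal length in an ideal *)

(** The interval is half-open, so that [n] is a length and a nonzero element
    has [n > 0]. *)
Definition window (p : int) (n : nat) (z : A) : Prop :=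
  forall k, ~~ (p <= k < p + Posz n) -> gwa_coef z k = 0.

Lemma window_vM j p n z : window p n z -> window (j + p) n (v j * z).
Proof.
move=> zW k kW; rewrite (_ : k = j + (k - j)); last by lia.
by apply/coef_vM_eq0/zW; lia.
Qed.

Lemma window_Mv j p n z : window p n z -> window (p + j) n (z * v j).
Proof.
move=> zW k kW; rewrite (_ : k = k - j + j); last by lia.
by apply/coef_Mv_eq0/zW; lia.
Qed.

Lemma window_dM d p n z : window p n z -> window p n (d%:G * z).
Proof. by move=> zW k /zW k0; rewrite coef_dM k0 mulr0. Qed.

Lemma window_Md d p n z : window p n z -> window p n (z * d%:G).
Proof. by move=> zW k /zW k0; rewrite coef_Md k0 mul0r. Qed.

Lemma windowB p n z w : window p n z -> window p n w -> window p n (z - w).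
Proof. by move=> zW wW k kW; rewrite coefB zW ?wW ?subr0. Qed.

Lemma window_shrinkl p n z : window p n.+1 z -> gwa_coef z p = 0 ->
  window (p + 1) n z.
Proof.
by move=> zW z0 k kW; have [->|kp] := eqVneq k p; [|apply: zW; lia].
Qed.

Lemma window_shrinkr p n z : window p n.+1 z -> gwa_coef z (p + Posz n) = 0 ->
  window p n z.
Proof.
move=> zW z0 k kW.
by have [->|kp] := eqVneq k (p + Posz n); [|apply: zW; lia].
Qed.

Section SimplicityCriterion.

Hypotheses (a_lreg : forall d, a * d = 0 -> d = 0)
  (sa_lreg : forall d, sigma a * d = 0 -> d = 0).

Lemma v_lreg k z : v k * z = 0 -> z = 0.
Proof.
have x_lreg u : x * u = 0 -> u = 0.
  move=> xu; apply: coef_inj => j; apply: a_lreg.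
  by rewrite -coef_dM -gwa_yx -mulrA xu mulr0 coef0.
have y_lreg u : y * u = 0 -> u = 0.
  move=> yu; apply: coef_inj => j; apply: sa_lreg.
  by rewrite -coef_dM -gwa_xy -mulrA yu mulr0 coef0.
case: k => i /=; elim: i => [|i IH].
- by rewrite mul1r.
- by rewrite exprS -mulrA => /x_lreg.
- by rewrite expr1 => /y_lreg.
- by rewrite exprS -mulrA => /y_lreg.
Qed.

Lemma iter_sigma_eq0 n d : iter n sigma d = 0 -> d = 0.
Proof.
elim: n => //= n IH sd; apply/IH/a_lreg.
by rewrite a_comm sd rmorph0 mul0r.
Qed.

Variable J : set A.
Hypothesis idJ : ideal J.

Variable n : nat.
Hypothesis n_min : forall p z, J z -> window p n z -> z = 0.

Let JB z w : J z -> J w -> J (z - w).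
Proof.
by move=> Jz Jw; apply: (idealD idJ) => //; rewrite -mulN1r; apply: idealMl.
Qed.

(** Each property of [d] comes from an element of [J] shorter than [w],
    hence zero: [w r - sigma^n(r) w] lacks degree [n], [x w - w x] lacks
    degree [n + 1] (and degree 0), and [w r], resp. [r w], lacks degree 0
    when [d r = 0], resp. [r d = 0]. *)
Lemma minimal_element_omega w : (1 <= n)%N -> J w ->
  window 0 n.+1 w -> gwa_coef w n = 1 -> ~ no_power_is_omega sigma.
Proof.
move=> n1 Jw wW wn; apply; pose d := gwa_coef w 0.
have wr_n r : gwa_coef (w * r%:G) n = iter n sigma r.
  by rewrite coef_Md wn mul1r.
have dr r : d * r = iter n sigma r * d.
  apply/eqP; rewrite -subr_eq0 -[d * r](coef_Md w r 0) -coef_dM -coefB.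
  rewrite (@n_min 0 (w * r%:G - (iter n sigma r)%:G * w)) ?coef0 //.
    by apply: JB; [apply: idealMr | apply: idealMl].
  apply: window_shrinkr.
    by apply: windowB; [apply: window_Md | apply: window_dM].
  by rewrite add0r coefB wr_n coef_dM wn mulr1 subrr.
have sd : sigma d = d.
  have xw_wx : x * w - w * x = 0.
    apply: (@n_min 1); first by apply: JB; [apply: idealMl | apply: idealMr].
    apply: window_shrinkr.
      apply: windowB.
        by have := window_vM (j := 1) wW; rewrite /= expr1 addr0.
      by have := window_Mv (j := 1) wW; rewrite /= expr1 add0r.
    rewrite coefB coef_xM coef_Mx (_ : 1 + Posz n - 1 = n); last by lia.
    have -> : (0 < 1 + Posz n) = true by lia.
    by rewrite wn !mulr1 rmorph1 subrr.
  have := coef0 1; rewrite -[0 in X in X -> _]xw_wx coefB coef_xM coef_Mx.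
  rewrite subrr ltr01 !mulr1.
  by move/eqP; rewrite subr_eq0 => /eqP.
have rd : regular d.
  split; [apply: mulrI0_lreg | apply: mulIr0_rreg] => r r0.
    apply: (@iter_sigma_eq0 n); rewrite -wr_n (@n_min 1 (w * r%:G)) ?coef0 //.
      exact: idealMr.
    have := window_shrinkl (window_Md r wW); rewrite add0r.
    by apply; rewrite coef_Md.
  rewrite -[r]mulr1 -wn -coef_dM (@n_min 1 (r%:G * w)) ?coef0 //.
    exact: idealMl.
  have := window_shrinkl (window_dM r wW); rewrite add0r.
  by apply; rewrite coef_dM.
have nd : left_normal d.
  by move=> _ [r _ <-]; exists (iter n sigma r); rewrite ?dr.
exists n, d, rd, nd; split=> //.
by apply/funext => r; apply: omega_unique (dr r).
Qed.

Hypothesis Iprime_full : forall I : set D,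
  ideal I -> I <> [set 0] -> Iprime sigma tau a I = setT.

(** The coefficients in degree 0 of the elements of [J] supported in
    [-n .. 0] form a two-sided ideal [T], because right multiplication by
    [D] is not twisted in degree 0. For such an element [w], the product
    [v k * w * v (- k)] is again of this kind, whence [Iprime T] is in [T]. *)
Lemma minimal_top_coef1 z p : J z -> z <> 0 -> window p n.+1 z ->
  exists w, [/\ J w, window (- Posz n) n.+1 w & gwa_coef w 0 = 1].
Proof.
move=> Jz z0 zW.
pose T : set D :=
  [set gwa_coef w 0 | w in [set w | J w /\ window (- Posz n) n.+1 w]].
have idT : ideal T.
  split.
  - exists 0; last exact: coef0.
    by split; [exact: ideal0 | move=> k _; exact: coef0].
  - move=> _ _ [w [Jw wW] <-] [w' [Jw' wW'] <-].
    exists (w + w'); last exact: coefD.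
    by split; [exact: idealD | move=> k kW; rewrite coefD wW ?wW' ?addr0].
  - move=> r _ [w [Jw wW] <-]; exists (r%:G * w); last exact: coef_dM.
    by split; [exact: idealMl | exact: window_dM].
  - move=> r _ [w [Jw wW] <-]; exists (w * r%:G); last exact: coef_Md.
    by split; [exact: idealMr | exact: window_Md].
pose u := v (- Posz n - p) * z.
have Ju : J u by apply: idealMl.
have uW : window (- Posz n) n.+1 u.
  by have := window_vM (j := - Posz n - p) zW; rewrite subrK.
have T_neq0 : T <> [set 0].
  move=> T0; apply: z0; apply: (@v_lreg (- Posz n - p)); apply: (n_min Ju).
  apply: (window_shrinkr uW).
  have : T (gwa_coef u 0) by exists u.
  by rewrite T0 addNr.
have TvMv w k : J w -> window (- Posz n) n.+1 w ->
    T (gwa_coef (v k * (gwa_coef w 0)%:G * v (- k)) 0).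
  move=> Jw wW; rewrite -coef_vMv; exists (v k * w * v (- k)) => //; split.
    by apply: idealMr => //; apply: idealMl.
  have := window_Mv (j := - k) (window_vM (j := k) wW).
  by rewrite addrAC subrr add0r.
have : T 1.
  suff TT : T = setT by rewrite TT.
  rewrite -(Iprime_full idT T_neq0); apply/seteqP; split.
    exact: subset_Iprime.
  apply: Iprime_subset => //.
    by split; [exact: ideal0 | exact: idealD | exact: idealMl].
  - by move=> i _ [w [Jw wW] <-]; have := TvMv w i Jw wW; rewrite coef_vdv.
  - move=> [|i] _ [w [Jw wW] <-]; last first.
      by have := TvMv w (Negz i) Jw wW; rewrite coef_vdv.
    by rewrite /tau_prod big_ord0 mulr1; exists w.
by move=> [w [Jw wW] w1]; exists w.
Qed.

End SimplicityCriterion.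

Lemma simple_gwa :
  (forall d, a * d = 0 -> d = 0) -> (forall d, sigma a * d = 0 -> d = 0) ->
  (forall I : set D, ideal I -> I <> [set 0] -> Iprime sigma tau a I = setT) ->
  no_power_is_omega sigma -> simple_ring A.
Proof.
move=> a_lreg sa_lreg Iprime_full no_omega; split=> [A0|J idJ].
  have D0 : (1 : D) = 0.
    by apply: gwa_const_inj; rewrite rmorph1 A0.
  have all0 (r : D) : r = 0 by rewrite -[r]mulr1 D0 mulr0.
  apply: no_omega.
  (* in the zero ring, sigma is the endomorphism given by 0 *)
  have rd : regular (0 : D) by split=> r s _; rewrite (all0 r) (all0 s).
  have nd : left_normal (0 : D).
    by move=> r _; exists 0; rewrite // (all0 r) mulr0.
  exists 1%N, 0, rd, nd; split; rewrite ?rmorph0 //.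
  by apply/funext => r; rewrite (all0 (iter _ _ _)) (all0 (omega_end _ _ _)).
have [[z Jz z0]|noz] := pselect (exists2 z, J z & z <> 0); last first.
  left; apply/seteqP; split=> [z Jz|_ ->]; last exact: ideal0.
  by apply: contrapT => z0; apply: noz; exists z.
right; suff J1 : J 1.
  by apply/seteqP; split=> // w _; rewrite -[w]mulr1; apply: idealMl.
pose P n := `[< exists z p, [/\ J z, z <> 0 & window p n z] >].
have exP : exists n, P n.
  have [N zN] := coef_finite z; exists N.*2.+1; apply/asboolP.
  by exists z, (- Posz N); split=> // k kW; apply: zN; lia.
case: (ex_minnP exP) => -[|n] /asboolP[{z Jz z0} z [p [Jz z0 zW]]] n_le.
  by case: z0; apply: coef_inj => k; apply: zW; lia.
have n_min q w : J w -> window q n w -> w = 0.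
  move=> Jw wW; apply: contrapT => w0.
  suff /n_le : P n by rewrite ltnn.
  by apply/asboolP; exists w, q.
have [w [Jw wW w1]] :=
  minimal_top_coef1 a_lreg sa_lreg idJ n_min Iprime_full Jz z0 zW.
have [n0|n1] := posnP n.
  suff <- : w = 1 by [].
  apply/eqP; rewrite -subr_eq0; apply/eqP/coef_inj => k.
  rewrite coefB (coef_v 0 k).
  have [->|k0] := eqVneq k 0; first by rewrite w1 subrr.
  by rewrite subr0 wW //; lia.
have := @minimal_element_omega a_lreg J idJ n n_min (w * v n) n1.
case=> //; first exact: idealMr.
- by have := window_Mv (j := n) wW; rewrite addNr.
- apply/eqP; rewrite -subr_eq0 -[1](_ : gwa_coef (v n) n = 1); last first.
    by rewrite coef_v eqxx.
  rewrite -coefB -[X in _ - X]mul1r -mulrBl.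
  have := @coef_Mv_eq0 n (w - 1) 0; rewrite add0r coefB w1 (coef_v 0 0) subrr.
  by move=> /(_ erefl) ->.
Qed.

End Coefficients.

(** * The symmetry between the two generators *)

Section Swap.

Variables (D : pzRingType) (sigma tau : {rmorphism D -> D}) (a : D).
Hypothesis tau_sigma_a : tau (sigma a) = a.

Lemma gwa_swap :
  exists (g : {rmorphism gwa sigma tau a -> gwa tau sigma (sigma a)})
         (h : {rmorphism gwa tau sigma (sigma a) -> gwa sigma tau a}),
    [/\ cancel g h, cancel h g
      & g (gwa_y sigma tau a) = gwa_x tau sigma (sigma a)].
Proof.
have [||||g [gd gx gy]] := @gwa_lift _ sigma tau a _
  (gwa_const tau sigma (sigma a))
  (gwa_y tau sigma (sigma a)) (gwa_x tau sigma (sigma a)).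
- exact: gwa_yd.
- exact: gwa_xd.
- by rewrite gwa_xy tau_sigma_a.
- exact: gwa_yx.
have [||||h [hd hx hy]] := @gwa_lift _ tau sigma (sigma a) _
  (gwa_const sigma tau a) (gwa_y sigma tau a) (gwa_x sigma tau a).
- exact: gwa_yd.
- exact: gwa_xd.
- by rewrite gwa_xy.
- by rewrite gwa_yx tau_sigma_a.
exists g, h; split=> // z.
- elim/gwa_ind: z => [d|||z IH|z w IHz IHw|z w IHz IHw].
  + by rewrite gd hd.
  + by rewrite gx hy.
  + by rewrite gy hx.
  + by rewrite !rmorphN IH.
  + by rewrite !rmorphD IHz IHw.
  + by rewrite !rmorphM IHz IHw.
- elim/gwa_ind: z => [d|||z IH|z w IHz IHw|z w IHz IHw].
  + by rewrite hd gd.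
  + by rewrite hx gy.
  + by rewrite hy gx.
  + by rewrite !rmorphN IH.
  + by rewrite !rmorphD IHz IHw.
  + by rewrite !rmorphM IHz IHw.
Qed.

End Swap.

Lemma simple_ring_iso (R S : pzRingType) (g : {rmorphism R -> S})
    (h : {rmorphism S -> R}) :
  cancel g h -> cancel h g -> simple_ring R -> simple_ring S.
Proof.
move=> gK hK [R1 Rsimple]; split=> [S1|I [I0 ID IMl IMr]].
  by apply: R1; rewrite -(rmorph1 h) S1 rmorph0.
have idgI : ideal (g @^-1` I).
  split=> [|r s Ir Is|r s Is|r s Is];
    rewrite /preimage /= ?rmorph0 ?rmorphD ?rmorphM //.
  - exact: ID.
  - exact: IMl.
  - exact: IMr.
have IE s : I s <-> (g @^-1` I) (h s) by rewrite /preimage /= hK.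
have [gI|gI] := Rsimple _ idgI; [left|right]; apply/seteqP; split=> // s.
- by move=> /IE; rewrite gI => hs; rewrite /= -(hK s) hs rmorph0.
- by move=> ->.
- by move=> _; apply/IE; rewrite gI.
Qed.

(** * The simplicity criterion *)

Section Criterion.

Variables (D : pzRingType) (sigma tau : {rmorphism D -> D}) (a : D).
Hypotheses (tau_sigma_a : tau (sigma a) = a)
  (a_comm : forall d : D, a * d = tau (sigma d) * a)
  (sigma_a_comm : forall d : D, sigma a * d = sigma (tau d) * sigma a).

Lemma swap_sigma_a_comm d : tau (sigma a) * d = tau (sigma d) * tau (sigma a).
Proof. by rewrite tau_sigma_a a_comm. Qed.

Lemma swap_tau_sigma_a : sigma (tau (sigma a)) = sigma a.
Proof. by rewrite tau_sigma_a. Qed.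

Lemma simple_gwa_swap :
  simple_ring (gwa sigma tau a) <-> simple_ring (gwa tau sigma (sigma a)).
Proof.
have [g [h [gK hK _]]] := gwa_swap tau_sigma_a.
by split; [exact: simple_ring_iso gK hK | exact: simple_ring_iso hK gK].
Qed.

Lemma simple_gwa_regular : simple_ring (gwa sigma tau a) ->
  [/\ regular a, regular (sigma a), injective sigma & injective tau].
Proof.
move=> simpleA; apply: simple_regular => // z yz.
have [g [h [gK _ gy]]] := gwa_swap tau_sigma_a.
have x_lreg := @simple_x_lreg _ _ _ _
  swap_tau_sigma_a sigma_a_comm swap_sigma_a_comm.
rewrite -(gK z) (x_lreg _ (g z)) ?rmorph0 //.
  exact: (simple_gwa_swap.1 simpleA).
by rewrite -gy -rmorphM yz rmorph0.
Qed.

Lemma simple_gwaP : simple_ring (gwa sigma tau a) <->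
  [/\ regular a /\ regular (sigma a),
      forall I : set D, ideal I -> I <> [set 0] -> Iprime sigma tau a I = setT
    & no_power_is_omega sigma].
Proof.
split=> [simpleA|[[ra rsa] Iprime_full no_omega]].
  have [ra rsa _ _] := simple_gwa_regular simpleA.
  split=> // [I|]; first exact: simple_Iprime.
  exact: (simple_no_power_is_omega tau_sigma_a a_comm sigma_a_comm simpleA).
apply: simple_gwa => // d d0; [apply: ra.1|apply: rsa.1];
  by rewrite mulr0.
Qed.

End Criterion.

Theorem theorem3p2 (D : pzRingType) (sigma tau : {rmorphism D -> D}) (a : D)
    (tau_sigma_a : tau (sigma a) = a)
    (a_comm : forall d : D, a * d = tau (sigma d) * a)
    (sigma_a_comm : forall d : D, sigma a * d = sigma (tau d) * sigma a) :
  let cond1 := simple_ring (gwa sigma tau a) in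
  let cond_a := regular a /\ regular (sigma a) in
  let cond_b := forall I : set D,
    ideal I -> I <> [set 0] -> Iprime sigma tau a I = setT in
  let cond2 := [/\ cond_a, cond_b & no_power_is_omega sigma] in
  let cond3 := [/\ cond_a, cond_b & no_power_is_omega tau] in
  [/\ cond1 <-> cond2,
      cond1 <-> cond3
    & cond1 \/ cond2 \/ cond3 -> injective sigma /\ injective tau].
Proof.
  move=> cond1 cond_a cond_b cond2 cond3.
  have criterion : cond1 <-> cond2 by exact: simple_gwaP.
  have criterion_swap : cond1 <-> cond3.
    rewrite /cond1 (simple_gwa_swap tau_sigma_a).
    rewrite (simple_gwaP (swap_tau_sigma_a tau_sigma_a) sigma_a_comm
      (swap_sigma_a_comm tau_sigma_a a_comm)).
    rewrite tau_sigma_a (Iprime_swap tau_sigma_a).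
    by split=> -[[? ?] ? ?]; split.
  split=> // -[simpleA|[/criterion simpleA|/criterion_swap simpleA]];
    by have [] := simple_gwa_regular tau_sigma_a a_comm sigma_a_comm simpleA.
Qed.
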